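(* Fix $\kappa>0$. Let $A\in C^0(\mathbb{R},\mathrm{SL}(2,\mathbb{R}))\cap C^2(\mathbb{R},\mathbb{M}^2)$ be a solution of $\ddot A(t)+\kappa A(t)=\lambda(t)\,\mathrm{cof}\,A(t)$ such that the quantity $|A(t)|$ is nonconstant and $T$-periodic for some $T>0$. For every $N\in\mathbb{N}$, there exists $\ell\in\{1,\ldots,N^2\}$ depending on $N$ such that $$|A(2\ell T+t)-A(t)|\le 8\pi|A(t)|/N\qquad\text{for all }t\in\mathbb{R}.$$ If $A(t)$ is rigid, then either $A(t)$ is periodic or the range of $A(t)$ is dense in the sphere of radius $|A(0)|$ in $\mathrm{SL}(2,\mathbb{R})$.
   Context: $\mathbb{N}$ is the set of positive integers. $\mathbb{M}^2$ is the space of real $2\times2$ matrices with norm $|A|=(\mathrm{tr}\,A^\top A)^{1/2}$. $\mathrm{SL}(2,\mathbb{R})=\{A\in\mathbb{M}^2:\det A=1\}$, and the sphere of radius $r$ in $\mathrm{SL}(2,\mathbb{R})$ is $\{A\in\mathrm{SL}(2,\mathbb{R}):|A|=r\}$. $Z=\begin{bmatrix}0&-1\\1&0\end{bmatrix}$ and $\mathrm{cof}\,A=ZAZ^\top$ is the cofactor matrix. A solution means that the equation holds for some $\lambda\in C^0(\mathbb{R},\mathbb{R})$ (necessarily $\lambda(t)=2(\kappa-\det\dot A(t))/|A(t)|^2$). A solution is called rigid if $|A(t)|$ is constant for all $t\in\mathbb{R}$. *)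

(* Defs.v *)
From mathcomp Require Import all_boot all_order all_algebra.
From mathcomp Require Import all_classical all_reals all_analysis.

Set Implicit Arguments.
Unset Strict Implicit.
Unset Printing Implicit Defensive.

Import Order.TTheory GRing.Theory Num.Theory.
Import numFieldNormedType.Exports.

Local Open Scope ring_scope.
Local Open Scope classical_set_scope.

(* The library norm `|A| on matrices is the max norm, hence this definition.
   The two norms induce the same topology, so derivatives, continuity and
   closures of matrix-valued functions are taken from the library. *)
Definition frob (R : realType) (A : 'M[R]_2) : R := Num.sqrt (\tr (A^T *m A)).

Definition SL2 (R : realType) : set 'M[R]_2 := [set A | \det A = 1].

Definition SL2_sphere (R : realType) (r : R) : set 'M[R]_2 :=
  [set A | SL2 A /\ frob A = r].

(* Z = [0, -1; 1, 0] *)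
Definition Zmx (R : realType) : 'M[R]_2 := delta_mx 1 0 - delta_mx 0 1.

Definition cof (R : realType) (A : 'M[R]_2) : 'M[R]_2 :=
  Zmx R *m A *m (Zmx R)^T.

Definition C2 (R : realType) (V : normedModType R) (f : R -> V) : Prop :=
  [/\ forall t, derivable f t 1,
      forall t, derivable f^`() t 1 &
      continuous f^`(2)].

Definition is_solution (R : realType) (kappa : R) (A : R -> 'M[R]_2) : Prop :=
  [/\ forall t, SL2 (A t),
      continuous A,
      C2 A &
      exists2 lambda : R -> R, continuous lambda &
        forall t, (A^`(2))%classic t + kappa *: A t = lambda t *: cof (A t)].

Definition rigid (R : realType) (A : R -> 'M[R]_2) : Prop :=
  exists c : R, forall t, frob (A t) = c.

Definition dense_in (T : topologicalType) (S D : set T) : Prop :=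
  S `<=` D /\ D `<=` closure S.

(* Main.v *)
Require Import Defs.
From mathcomp Require Import all_boot all_order all_algebra.
From mathcomp Require Import all_classical all_reals all_analysis.
From mathcomp Require Import ring lra.
Import Order.TTheory GRing.Theory Num.Theory.
Import numFieldNormedType.Exports.
Local Open Scope ring_scope.
Local Open Scope classical_set_scope.

(** Write the action of a real 2 x 2 matrix [A] on the complex plane as
    [v |-> z v + w (conj v)].  Then [det A = |z|^2 - |w|^2], the square of the
    Frobenius norm is [2 (|z|^2 + |w|^2)], and passing to the cofactor matrix
    changes the sign of [w].  The equation of motion splits into two motions in
    the plane under central linear forces,
    [z'' = (lambda - kappa) z] and [w'' = - (lambda + kappa) w],
    coupled by [|z|^2 - |w|^2 = 1] ([solution_central]).

    If [|A|] is [T]-periodic, so are [|z|^2] and [|w|^2].  Conservation of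
    energy expresses [lambda] through [|z|^2] and its second derivative, hence
    [lambda] is [T]-periodic as well ([multiplier_periodic]).  A central motion
    with periodic force and periodic modulus satisfies
    [z (t + T) = exp (i a) z t] for a constant [a]: at one time the value and,
    by conservation of the angular momentum, the velocity are turned by the
    same angle, and solutions of a linear equation are determined by their
    value and velocity ([central_motion_floquet]).  So [A (t + n T)] is obtained
    from [A t] by turning [z] by [n a] and [w] by [n b], and simultaneous
    Diophantine approximation ([dirichlet2]) provides the required multiple.

    If [|A|] is constant, both motions are uniform rotations,
    [z t = exp (i a t) z 0] and [w t = exp (i b t) w 0]
    ([central_motion_circular]), while a sphere in SL2 is the torus on which
    [|z|] and [|w|] are fixed.  By [kronecker], such a curve on a torus is
    periodic or dense. *)

(** * Diophantine approximation *)

(** Dirichlet's simultaneous approximation: among the [N ^ 2 + 1] pairs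
    [(l x, l y)] modulo 1 with [0 <= l <= N ^ 2], two lie in the same one of the
    [N ^ 2] boxes of side [1 / N]. *)
Lemma dirichlet2 {R : realType} (x y : R) (N : nat) (N_gt0 : (0 < N)%N) :
  exists2 l : nat, (1 <= l <= N ^ 2)%N &
    exists j k : int, `|l%:R * x - j%:~R| < N%:R^-1 /\
                      `|l%:R * y - k%:~R| < N%:R^-1.
Proof.
case: N N_gt0 => [//|n] _; set N := n.+1.
have N0 : 0 < N%:R :> R by rewrite ltr0n.
pose fr (z : R) := z - (Num.floor z)%:~R.
have fr_ge0 z : 0 <= fr z by rewrite subr_ge0 floor_le.
have fr_lt1 z : fr z < 1.
  by have /andP[_] := floor_itv z; rewrite rmorphD/= -ltrBlDl.
pose box z : 'I_N := inord (Num.trunc (N%:R * fr z)).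
have boxE z : box z = Num.trunc (N%:R * fr z) :> nat.
  rewrite inordK// truncn_lt_nat ?mulr_ge0 ?ler0n//.
  by rewrite -[ltRHS]mulr1 ltr_pM2l.
have box_close z1 z2 : box z1 = box z2 -> `|fr z1 - fr z2| < N%:R^-1.
  move=> /(congr1 val)/=; rewrite !boxE => e.
  have /truncn_itv := mulr_ge0 (ltW N0) (fr_ge0 z1).
  have /truncn_itv := mulr_ge0 (ltW N0) (fr_ge0 z2).
  rewrite e -natr1 => /andP[a1 a2] /andP[a3 a4].
  rewrite -(ltr_pM2l N0) mulfV ?gt_eqF// -[X in X * _](ger0_norm (ltW N0)).
  by rewrite -normrM mulrBr ltr_norml; apply/andP; split; lra.
pose f (l : 'I_(N ^ 2).+1) := (box (l%:R * x), box (l%:R * y)).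
have /injectivePn [l1 [l2 l12 [fx fy]]] : ~~ injectiveb f.
  apply/negP => /injectiveP/leq_card.
  by rewrite card_prod !card_ord mulnn ltnn.
wlog lt12 : l1 l2 l12 fx fy / (l1 < l2)%N.
  move=> W; move: (l12); rewrite -val_eqE/= neq_ltn => /orP[h|h].
    exact: (W l1 l2).
  by apply: (W l2 l1) => //; rewrite eq_sym.
exists (l2 - l1)%N.
  rewrite subn_gt0 lt12/=.
  by rewrite (leq_trans (leq_subr _ _))// -ltnS.
exists (Num.floor (l2%:R * x) - Num.floor (l1%:R * x)),
  (Num.floor (l2%:R * y) - Num.floor (l1%:R * y)).
rewrite natrB 1?ltnW// !rmorphB/=.
split.
- have := box_close _ _ (esym fx); rewrite /fr; congr (`|_| < _); ring.
- have := box_close _ _ (esym fy); rewrite /fr; congr (`|_| < _); ring.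
Qed.

(** The integer combinations of 1 and an irrational number are dense: by
    Dirichlet one of them, [d], is nonzero and small, and [a] is within [d] of a
    multiple of [d]. *)
Lemma int_span_dense {R : realType} (x a e : R) :
  (forall (n : nat) (k : int), (0 < n)%N -> n%:R * x != k%:~R) -> 0 < e ->
  exists j k : int, `|j%:~R * x - k%:~R - a| < e.
Proof.
move=> irr e0.
pose N := (Num.trunc e^-1).+1.
have N0 : 0 < N%:R :> R by rewrite ltr0n.
have Ne : N%:R^-1 < e.
  by rewrite -[ltRHS]invrK ltf_pV2 ?posrE ?invr_gt0// truncnS_gt.
have [l /andP[l0 _] [j [_ [lj _]]]] := @dirichlet2 R x 0 N isT.
have d0 : l%:R * x - j%:~R != 0 by rewrite subr_eq0 irr.
set d := l%:R * x - j%:~R in lj d0 *.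
pose m := Num.floor (a / d).
exists (m * l%:Z), (m * j).
have -> : (m * l%:Z)%:~R * x - (m * j)%:~R - a = - (a / d - m%:~R) * d.
  rewrite mulNr mulrBl divfK// !intrM /d; ring.
rewrite normrM normrN.
have /andP[h1 h2] := floor_itv (a / d).
rewrite rmorphD/= in h2.
apply: lt_trans (lt_trans lj Ne).
rewrite -[ltRHS]mul1r ltr_pM2r ?normr_gt0//.
by rewrite ger0_norm ?subr_ge0// ltrBlDl.
Qed.

(** A linear flow on the torus is periodic or comes arbitrarily close to every
    point, reaching the first coordinate exactly. *)
Lemma kronecker {R : realType} (a b : R) :
  (exists2 P : R, 0 < P & exists j k : int, a * P = j%:~R /\ b * P = k%:~R) \/
  (forall phi psi e : R, 0 < e ->
     exists t : R, exists j k : int,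
       a * t = phi + j%:~R /\ `|b * t - psi - k%:~R| < e).
Proof.
have period (c : R) : c != 0 -> c * `|c|^-1 = (sgz c)%:~R.
  by move=> c0; rewrite {1}[c]numEsg mulfK ?normr_eq0// sgrEz.
have [->|a0] := eqVneq a 0.
  left; have [->|b0] := eqVneq b 0.
    by exists 1 => //; exists 0, 0; rewrite !mul0r.
  exists `|b|^-1; first by rewrite invr_gt0 normr_gt0.
  by exists 0, (sgz b); rewrite mul0r period.
have [[n [k [n0 e]]]|irr] :=
    pselect (exists (n : nat) (k : int), (0 < n)%N /\ n%:R * (b / a) = k%:~R).
  left; exists (n%:R * `|a|^-1).
    by rewrite mulr_gt0 ?ltr0n// invr_gt0 normr_gt0.
  exists (n%:Z * sgz a), (k * sgz a); split.
    by rewrite mulrCA period// intrM.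
  by rewrite intrM -e -period//; field; rewrite normr_eq0 a0.
right=> phi psi e e0.
have [|j [k jk]] := @int_span_dense R (b / a) (psi - phi * (b / a)) e _ e0.
  by move=> n k n0; apply/eqP => h; apply: irr; exists n, k.
exists ((phi + j%:~R) / a), j, k; split; first by rewrite mulrC divfK.
by move: jk; congr (`|_| < _); field.
Qed.

(** * Plane rotations *)

Lemma sin_cos_int_period {R : realType} (x : R) (k : int) :
  cos (x + k%:~R * (pi *+ 2)) = cos x /\ sin (x + k%:~R * (pi *+ 2)) = sin x.
Proof.
have P (n : nat) (y : R) : cos (y + n%:R * (pi *+ 2)) = cos y /\
                 sin (y + n%:R * (pi *+ 2)) = sin y.
  by rewrite mulr_natl (periodicn (@cosD2pi R)) (periodicn (@sinD2pi R)).
case: k => n; first exact: P.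
have [<- <-] := P n.+1 (x + (Negz n)%:~R * (pi *+ 2)).
by rewrite NegzE mulrNz mulNr -[_ *~ _]/(n.+1%:R) addrNK.
Qed.

(** The chord of the angle [x] on the unit circle is no longer than the arc:
    [2 - 2 * cos x] is the squared modulus of [exp (i x) - 1]. *)
Lemma two_sub_2cos_le {R : realType} (x : R) : 2 - 2 * cos x <= x ^+ 2.
Proof.
have sq (y : R) : 0 <= y -> 2 - 2 * cos y <= y ^+ 2.
  rewrite le_eqVlt => /predU1P[<-|y0].
    by rewrite cos0 expr0n/= mulr1 subrr.
  have sinle (z : R) : 0 < z -> sin z <= z.
    move=> z0.
    have [|c _ e] := @MVT R (@sin R) (@cos R) 0 z z0 (fun t _ => is_derive_sin t).
      by apply: continuous_subspaceT; exact: continuous_sin.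
    move: e; rewrite sin0 !subr0 => ->.
    by rewrite ler_piMl ?cos_le1// ltW.
  pose F (z : R) := z ^+ 2 + 2 * cos z.
  have dF (z : R) : is_derive z 1 F (2 * (z - sin z)).
    rewrite /F; apply: is_derive_eq.
    by rewrite /GRing.scale/=; ring.
  have [|c c0 e] := @MVT R F _ 0 y y0 (fun z _ => dF z).
    apply: continuous_subspaceT => z.
    exact/differentiable_continuous/derivable1_diffP.
  move: e; rewrite /F cos0 expr0n/= subr0 => e.
  have : 0 <= 2 * (c - sin c) * y.
    rewrite mulr_ge0 ?mulr_ge0 ?subr_ge0 ?sinle ?ltW//.
    by move: c0; rewrite in_itv/= => /andP[].
  rewrite -e; lra.
have [/sq//|/ltW x0] := leP 0 x.
by rewrite -sqrrN -cosN sq// oppr_ge0.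
Qed.

(** Complex multiplication by [exp (i theta)], in real coordinates. *)
Definition rotated {R : realType} (theta : R) (v v' : R * R) : Prop :=
  v'.1 = cos theta * v.1 - sin theta * v.2 /\
  v'.2 = sin theta * v.1 + cos theta * v.2.

Lemma rotated0 {R : realType} (v : R * R) : rotated 0 v v.
Proof. by split; rewrite cos0 sin0; ring. Qed.

Lemma rotatedD {R : realType} {a b : R} {u v w : R * R} :
  rotated a u v -> rotated b v w -> rotated (a + b) u w.
Proof.
by move=> [u1 u2] [v1 v2]; split; rewrite ?v1 ?v2 u1 u2 cosD sinD; ring.
Qed.

Lemma rotated_period {R : realType} {a : R} (k : int) {u v : R * R} :
  rotated (a + k%:~R * (pi *+ 2)) u v -> rotated a u v.
Proof. by rewrite /rotated !(sin_cos_int_period a k).1 !(sin_cos_int_period a k).2. Qed.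

Lemma rotated_det {R : realType} {a : R} {u v w : R * R} :
  rotated a u v -> rotated a u w -> v = w.
Proof.
by case: v => ? ?; case: w => ? ? [/= -> ->] [/= -> ->].
Qed.

Lemma rotated_dist {R : realType} {a : R} {u v : R * R} :
  rotated a u v ->
  (v.1 - u.1) ^+ 2 + (v.2 - u.2) ^+ 2 <= a ^+ 2 * (u.1 ^+ 2 + u.2 ^+ 2).
Proof.
move=> [-> ->].
apply: (@le_trans _ _ ((2 - 2 * cos a) * (u.1 ^+ 2 + u.2 ^+ 2))).
  rewrite le_eqVlt; apply/orP; left; apply/eqP.
  rewrite (_ : 2 - 2 * cos a = (cos a ^+ 2 + sin a ^+ 2) + 1 - 2 * cos a).
    by ring.
  by rewrite cos2Dsin2; ring.
by rewrite ler_wpM2r ?two_sub_2cos_le// addr_ge0 ?sqr_ge0.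
Qed.

Lemma unit_circle_angle {R : realType} (c s : R) : c ^+ 2 + s ^+ 2 = 1 ->
  exists theta : R, cos theta = c /\ sin theta = s.
Proof.
move=> e.
have c1 : -1 <= c <= 1.
  rewrite -ler_norml -(@ler_pXn2r _ 2%N) ?nnegrE// real_normK ?num_real//.
  by rewrite expr1n -e lerDl sqr_ge0.
have sE : Num.sqrt (1 - c ^+ 2) = `|s| by rewrite -e addrAC subrr add0r sqrtr_sqr.
have [s0|s0] := leP 0 s.
  by exists (acos c); rewrite acosK ?in_itv// sin_acos// sE ger0_norm.
exists (- acos c).
by rewrite cosN sinN acosK ?in_itv// sin_acos// sE ltr0_norm// opprK.
Qed.

Lemma rotated_exists {R : realType} (u v : R * R) :
  v.1 ^+ 2 + v.2 ^+ 2 = u.1 ^+ 2 + u.2 ^+ 2 -> exists theta, rotated theta u v.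
Proof.
case: u v => [p q] [p' q'] /= e.
have [n0|n0] := eqVneq (p ^+ 2 + q ^+ 2) 0.
  have z0 (x y : R) : x ^+ 2 + y ^+ 2 = 0 -> x = 0 /\ y = 0.
    move=> /eqP; rewrite paddr_eq0 ?sqr_ge0// !sqrf_eq0.
    by move=> /andP[/eqP-> /eqP->].
  exists 0; have [-> ->] := z0 _ _ n0.
  have [-> ->] := z0 _ _ (etrans e n0); exact: rotated0.
(* cos and sin of the angle are the coordinates of the quotient [v / u] of
   complex numbers *)
have [|th [hc hs]] := @unit_circle_angle R
    ((p * p' + q * q') / (p ^+ 2 + q ^+ 2)) ((p * q' - q * p') / (p ^+ 2 + q ^+ 2)).
  transitivity ((p' ^+ 2 + q' ^+ 2) / (p ^+ 2 + q ^+ 2)); first by field.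
  by rewrite e mulfV.
by exists th; split; rewrite /= hc hs; field.
Qed.

(** * Derivatives and linear equations of order two *)

Lemma is_derive1_continuous {R : realType} {f f1 : R -> R} :
  (forall t : R, is_derive t 1 f (f1 t)) -> continuous f.
Proof.
by move=> df t; apply/differentiable_continuous/derivable1_diffP; case: (df t).
Qed.

Lemma is_derive1_unique {R : realType} {f : R -> R} {t a b : R} :
  is_derive t 1 f a -> is_derive t 1 f b -> a = b.
Proof. by move=> [_ <-] [_ <-]. Qed.

Lemma is_derive1_cst {R : realType} {f f1 : R -> R} :
  (forall t : R, is_derive t 1 f (f1 t)) -> (forall t, f1 t = 0) ->
  forall s t, f s = f t.
Proof.
by move=> df f0 s t; apply: is_derive_0_is_cst => x; rewrite -(f0 x).
Qed.

Lemma is_derive1_translate {R : realType} {f f1 : R -> R} (a : R) :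
  (forall t : R, is_derive t 1 f (f1 t)) ->
  forall t : R, is_derive t 1 (fun s => f (s + a)) (f1 (t + a)).
Proof.
move=> df t; have sh := is_derive_shift t 1 a.
by have := @is_derive1_comp R f (shift a) t _ _ (df _) sh; rewrite mulr1.
Qed.

Lemma is_derive1_reflect {R : realType} {f f1 : R -> R} :
  (forall t : R, is_derive t 1 f (f1 t)) ->
  forall t : R, is_derive t 1 (fun s => f (- s)) (- f1 (- t)).
Proof.
move=> df t.
have dN := is_deriveNid t (1 : R).
by have := @is_derive1_comp R f -%R t _ _ (df _) dN; rewrite mulrN1.
Qed.

Lemma is_derive1_periodic {R : realType} {f f1 : R -> R} {T : R} :
  (forall t : R, is_derive t 1 f (f1 t)) -> periodic f T -> periodic f1 T.
Proof.
move=> df fT t; have := is_derive1_translate T df t.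
by rewrite (_ : (fun s => f (s + T)) = f) => [/is_derive1_unique|]; [apply|apply/funext].
Qed.

(** Gronwall's argument: with [C] a bound of [|1 + g|] on the interval,
    [(y ^ 2 + y1 ^ 2) exp (- C x)] is nonincreasing. *)
Lemma linear_ode_unique_right {R : realType} {g y y1 : R -> R} {s : R} :
  continuous g ->
  (forall t : R, is_derive t 1 y (y1 t)) ->
  (forall t : R, is_derive t 1 y1 (g t * y t)) ->
  y s = 0 -> y1 s = 0 -> forall t, s <= t -> y t = 0.
Proof.
move=> cg dy dy1 ys y1s t st.
have [|c _ Cmax] := @EVT_max R (fun t => `|1 + g t|) s t st.
  apply: continuous_subspaceT => x.
  by apply: cvg_norm; apply: cvgD; [exact: cvg_cst|exact: cg].
set C := `|1 + g c| in Cmax.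
pose F x := (y x ^+ 2 + y1 x ^+ 2) * expR (- C * x).
have dF (x : R) : is_derive x 1 F
    ((2 * (1 + g x) * (y x * y1 x) - C * (y x ^+ 2 + y1 x ^+ 2)) * expR (- C * x)).
  have dE : is_derive x 1 (fun z => expR (- C * z)) (expR (- C * x) * - C).
    have -> : (fun z => expR (- C * z)) = expR \o (fun z => - C * z) by [].
    apply: is_derive1_comp; apply: is_derive_eq.
    by rewrite /GRing.scale/= mulr1.
  rewrite /F; apply: is_derive_eq; rewrite /GRing.scale/=; ring.
have Fs : F s = 0 by rewrite /F ys y1s expr0n/= addr0 mul0r.
have Ft : F t <= 0.
  move: st; rewrite le_eqVlt => /predU1P[<-|st]; first by rewrite Fs.
  have [|d dst] := @MVT R F _ s t st (fun z _ => dF z).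
    exact/continuous_subspaceT/(is_derive1_continuous dF).
  rewrite Fs subr0 => ->.
  rewrite mulr_le0_ge0 ?subr_ge0 ?(ltW st)// mulr_le0_ge0 ?expR_ge0// subr_le0.
  have {}Cmax : `|1 + g d| <= C.
    by apply: Cmax; move: dst; rewrite !in_itv/= => /andP[/ltW-> /ltW->].
  apply: (@le_trans _ _ (`|1 + g d| * (2 * `|y d * y1 d|))).
    rewrite (le_trans (ler_norm _))// !normrM (ger0_norm (ler0n _ _)).
    by rewrite (mulrC 2) !mulrA.
  apply: ler_pM => //.
  rewrite normrM -(real_normK (num_real (y d))) -(real_normK (num_real (y1 d))).
  have := sqr_ge0 (`|y d| - `|y1 d|); lra.
have : y t ^+ 2 + y1 t ^+ 2 <= 0.
  by rewrite -(@ler_pM2r _ (expR (- C * t))) ?expR_gt0// mul0r.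
move=> h; apply/eqP; rewrite -sqrf_eq0 eq_le sqr_ge0 andbT.
by rewrite (le_trans _ h)// lerDl sqr_ge0.
Qed.

Lemma linear_ode_unique {R : realType} {g y y1 : R -> R} {s : R} :
  continuous g ->
  (forall t : R, is_derive t 1 y (y1 t)) ->
  (forall t : R, is_derive t 1 y1 (g t * y t)) ->
  y s = 0 -> y1 s = 0 -> forall t, y t = 0.
Proof.
move=> cg dy dy1 ys y1s t.
have [st|/ltW ts] := leP s t.
  exact: (linear_ode_unique_right cg dy dy1 ys y1s).
rewrite -[t]opprK.
apply: (@linear_ode_unique_right R (g \o -%R) (fun x => y (- x))
  (fun x => - y1 (- x)) (- s)).
- by move=> x; apply: continuous_comp; [exact: opp_continuous|exact: cg].
- exact: is_derive1_reflect.
- move=> x; have := is_derive1_reflect dy1 x => h.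
  by apply: is_derive_eq; rewrite opprK.
- by rewrite opprK.
- by rewrite opprK y1s oppr0.
- by rewrite lerN2.
Qed.

(** * Plane motions under a central linear force *)

(** The curve [(p, q)] moves in the plane under the central linear force
    [g t * (p, q)]; its velocity is [(p1, q1)]. *)
Definition central_motion {R : realType} (g p q p1 q1 : R -> R) : Prop :=
  forall t : R, [/\ is_derive t 1 p (p1 t), is_derive t 1 q (q1 t),
    is_derive t 1 p1 (g t * p t) & is_derive t 1 q1 (g t * q t)].

Section central_motion_theory.
Context {R : realType} {g p q p1 q1 : R -> R}.
Hypothesis pq : central_motion g p q p1 q1.

Let dp (t : R) : is_derive t 1 p (p1 t). Proof. by have [] := pq t. Qed.
Let dq (t : R) : is_derive t 1 q (q1 t). Proof. by have [] := pq t. Qed.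
Let dp1 (t : R) : is_derive t 1 p1 (g t * p t). Proof. by have [] := pq t. Qed.
Let dq1 (t : R) : is_derive t 1 q1 (g t * q t). Proof. by have [] := pq t. Qed.
#[local] Existing Instances dp dq dp1 dq1.

(** Conservation of the angular momentum. *)
Lemma central_motion_momentum s t :
  p s * q1 s - q s * p1 s = p t * q1 t - q t * p1 t.
Proof.
apply: (@is_derive1_cst R (fun t => p t * q1 t - q t * p1 t) (fun=> 0)) => // x.
by apply: is_derive_eq; rewrite /GRing.scale/=; ring.
Qed.

Lemma is_derive_central_motion_sqnorm (t : R) :
  is_derive t 1 (fun t => p t ^+ 2 + q t ^+ 2) (2 * (p t * p1 t + q t * q1 t)).
Proof. by apply: is_derive_eq; rewrite /GRing.scale/=; ring. Qed.

Lemma is_derive_central_motion_virial (t : R) :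
  is_derive t 1 (fun t => p t * p1 t + q t * q1 t)
    (p1 t ^+ 2 + q1 t ^+ 2 + g t * (p t ^+ 2 + q t ^+ 2)).
Proof. by apply: is_derive_eq; rewrite /GRing.scale/=; ring. Qed.

Lemma is_derive_central_motion_speed (t : R) :
  is_derive t 1 (fun t => p1 t ^+ 2 + q1 t ^+ 2)
    (2 * g t * (p t * p1 t + q t * q1 t)).
Proof. by apply: is_derive_eq; rewrite /GRing.scale/=; ring. Qed.

(** Over one period of the force and of the modulus, a central motion is turned
    by an angle that does not depend on the initial time. *)
Lemma central_motion_floquet (T : R) :
  continuous g -> periodic g T -> periodic (fun t => p t ^+ 2 + q t ^+ 2) T ->
  exists theta, forall t, rotated theta (p t, q t) (p (t + T), q (t + T)).
Proof.
move=> cg gT rT.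
have [[s s0]|z] := pselect (exists s, p s ^+ 2 + q s ^+ 2 != 0); last first.
  have z0 t : p t = 0 /\ q t = 0.
    have /eqP : p t ^+ 2 + q t ^+ 2 = 0.
      by apply: contra_notP z => /eqP; exists t.
    by rewrite paddr_eq0 ?sqr_ge0// !sqrf_eq0 => /andP[/eqP-> /eqP->].
  exists 0 => t; have [-> ->] := z0 t; have [-> ->] := z0 (t + T).
  exact: rotated0.
have [th [/= hp hq]] :=
  @rotated_exists R (p s, q s) (p (s + T), q (s + T)) (rT s).
have vir : p (s + T) * p1 (s + T) + q (s + T) * q1 (s + T) =
           p s * p1 s + q s * q1 s.
  have := is_derive1_periodic is_derive_central_motion_sqnorm rT s.
  by move=> /(mulfI _); apply; rewrite pnatr_eq0.
have mom := central_motion_momentum (s + T) s.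
have rs : p s ^+ 2 + q s ^+ 2 = p (s + T) ^+ 2 + q (s + T) ^+ 2 by rewrite -(rT s).
(* the velocity is determined by the position, [vir] and [mom] *)
have hp1 : p1 (s + T) = cos th * p1 s - sin th * q1 s.
  apply: (mulfI s0).
  transitivity (p (s + T) * (p (s + T) * p1 (s + T) + q (s + T) * q1 (s + T))
   - q (s + T) * (p (s + T) * q1 (s + T) - q (s + T) * p1 (s + T))).
    by rewrite rs; ring.
  by rewrite vir mom hp hq; ring.
have hq1 : q1 (s + T) = sin th * p1 s + cos th * q1 s.
  apply: (mulfI s0).
  transitivity (q (s + T) * (p (s + T) * p1 (s + T) + q (s + T) * q1 (s + T))
   + p (s + T) * (p (s + T) * q1 (s + T) - q (s + T) * p1 (s + T))).
    by rewrite rs; ring.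
  by rewrite vir mom hp hq; ring.
have dpT := is_derive1_translate T dp.
have dqT := is_derive1_translate T dq.
have dp1T := is_derive1_translate T dp1.
have dq1T := is_derive1_translate T dq1.
exists th => t; split => /=; apply/eqP; rewrite -subr_eq0; apply/eqP.
- apply: (@linear_ode_unique R g
    (fun t => p (t + T) - (cos th * p t - sin th * q t))
    (fun t => p1 (t + T) - (cos th * p1 t - sin th * q1 t)) s cg).
  + move=> x; apply: is_derive_eq; rewrite /GRing.scale/= gT; ring.
  + by rewrite hp subrr.
  + by rewrite hp1 subrr.
- apply: (@linear_ode_unique R g
    (fun t => q (t + T) - (sin th * p t + cos th * q t))
    (fun t => q1 (t + T) - (sin th * p1 t + cos th * q1 t)) s cg).
  + move=> x; apply: is_derive_eq; rewrite /GRing.scale/= gT; ring.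
  + by rewrite hq subrr.
  + by rewrite hq1 subrr.
Qed.

(** A central motion on a circle is a uniform rotation. *)
Lemma central_motion_circular :
  (forall t, p t ^+ 2 + q t ^+ 2 = p 0 ^+ 2 + q 0 ^+ 2) ->
  exists w, forall t, rotated (w * t) (p 0, q 0) (p t, q t).
Proof.
move=> rE.
have vir t : p t * p1 t + q t * q1 t = 0.
  have : is_derive t 1 (fun t => p t ^+ 2 + q t ^+ 2) 0.
    rewrite (_ : (fun _ => _) = cst (p 0 ^+ 2 + q 0 ^+ 2)); last exact/funext.
    exact: is_derive_cst.
  move=> /(is_derive1_unique (is_derive_central_motion_sqnorm t)) /eqP.
  by rewrite mulf_eq0 pnatr_eq0/= => /eqP.
have [r0|r0] := eqVneq (p 0 ^+ 2 + q 0 ^+ 2) 0.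
  have z0 t : p t = 0 /\ q t = 0.
    have /eqP : p t ^+ 2 + q t ^+ 2 = 0 by rewrite rE.
    by rewrite paddr_eq0 ?sqr_ge0// !sqrf_eq0 => /andP[/eqP-> /eqP->].
  exists 0 => t; have [-> ->] := z0 t; have [-> ->] := z0 0.
  rewrite mul0r; exact: rotated0.
pose w := (p 0 * q1 0 - q 0 * p1 0) / (p 0 ^+ 2 + q 0 ^+ 2).
have p1E t : p1 t = - w * q t.
  apply: (mulfI r0); rewrite mulrA mulrN mulrCA mulfV// mulr1.
  rewrite (central_motion_momentum 0 t) -(rE t).
  transitivity (p t * (p t * p1 t + q t * q1 t)
    - (p t * q1 t - q t * p1 t) * q t); first by ring.
  by rewrite vir; ring.
have q1E t : q1 t = w * p t.
  apply: (mulfI r0); rewrite mulrA mulrCA mulfV// mulr1.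
  rewrite (central_motion_momentum 0 t) -(rE t).
  transitivity (q t * (p t * p1 t + q t * q1 t)
    + (p t * q1 t - q t * p1 t) * p t); first by ring.
  by rewrite vir; ring.
exists w => t.
have dwt (x : R) : is_derive x 1 (fun x => w * x) w.
  by apply: is_derive_eq; rewrite /GRing.scale/= mulr1.
have dc (x : R) : is_derive x 1 (fun x => cos (w * x)) (- sin (w * x) * w).
  exact: (@is_derive1_comp R cos (fun x => w * x)).
have ds (x : R) : is_derive x 1 (fun x => sin (w * x)) (cos (w * x) * w).
  exact: (@is_derive1_comp R sin (fun x => w * x)).
(* turning back by the angle [w * t] freezes the motion *)
have e1 : cos (w * t) * p t + sin (w * t) * q t = p 0.
  transitivity (cos (w * 0) * p 0 + sin (w * 0) * q 0).
    apply: (@is_derive1_cst R (fun x => cos (w * x) * p x + sin (w * x) * q x)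
      (fun=> 0)) => // x.
    by apply: is_derive_eq; rewrite /GRing.scale/= p1E q1E; ring.
  by rewrite mulr0 cos0 sin0; ring.
have e2 : cos (w * t) * q t - sin (w * t) * p t = q 0.
  transitivity (cos (w * 0) * q 0 - sin (w * 0) * p 0).
    apply: (@is_derive1_cst R (fun x => cos (w * x) * q x - sin (w * x) * p x)
      (fun=> 0)) => // x.
    by apply: is_derive_eq; rewrite /GRing.scale/= p1E q1E; ring.
  by rewrite mulr0 cos0 sin0; ring.
have cs := cos2Dsin2 (w * t).
by split=> /=; rewrite -e1 -e2 -[LHS]mul1r -cs; ring.
Qed.

End central_motion_theory.

(** * Conformal and anticonformal parts of a matrix *)

(** A real matrix acts on the complex plane as [v |-> z v + w (conj v)]; the
    next two definitions are the real coordinates of [z] (the conformal part)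
    and of [w] (the anticonformal part). *)
Definition conf {R : realType} (A : 'M[R]_2) : R * R :=
  ((A 0 0 + A 1 1) / 2, (A 1 0 - A 0 1) / 2).

Definition aconf {R : realType} (A : 'M[R]_2) : R * R :=
  ((A 0 0 - A 1 1) / 2, (A 1 0 + A 0 1) / 2).

(** The squared modulus of a complex number. *)
Definition sqn {R : realType} (v : R * R) : R := v.1 ^+ 2 + v.2 ^+ 2.

Lemma ord2E (P : 'I_2 -> Prop) : P 0 -> P 1 -> forall i, P i.
Proof.
by move=> P0 P1 [[|[|//]] h]; [move: P0|move: P1]; congr P; apply: val_inj.
Qed.

Lemma conf_aconf_inj {R : realType} (A B : 'M[R]_2) :
  conf A = conf B -> aconf A = aconf B -> A = B.
Proof.
move=> [a b] [c d].
by apply/matrixP; apply: ord2E; apply: ord2E; lra.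
Qed.

Lemma frob_ge0 {R : realType} (A : 'M[R]_2) : 0 <= frob A.
Proof. exact: sqrtr_ge0. Qed.

Lemma sqr_frob {R : realType} (A : 'M[R]_2) :
  frob A ^+ 2 = 2 * (sqn (conf A) + sqn (aconf A)).
Proof.
have trE : \tr (A^T *m A) = 2 * (sqn (conf A) + sqn (aconf A)).
  rewrite /mxtrace !big_ord_recl big_ord0 !mxE !big_ord_recl !big_ord0 !mxE.
  rewrite (_ : lift ord0 ord0 = 1); last exact: val_inj.
  by rewrite /sqn /conf /aconf /=; field.
by rewrite /frob sqr_sqrtr trE// mulr_ge0// !addr_ge0 ?sqr_ge0.
Qed.

Lemma det_conf_aconf {R : realType} (A : 'M[R]_2) :
  \det A = sqn (conf A) - sqn (aconf A).
Proof.
have l0 : lift (0 : 'I_2) (0 : 'I_1) = 1 by apply: val_inj.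
have l1 : lift (1 : 'I_2) (0 : 'I_1) = 0 by apply: val_inj.
rewrite (expand_det_row A 0) !big_ord_recl big_ord0 addr0.
rewrite /cofactor !det_mx11 !mxE -[ord0]/(0 : 'I_2) -[ord0]/(0 : 'I_1) !l0 l1.
rewrite addn0 add0n expr0 expr1.
by rewrite /sqn /conf /aconf /=; field.
Qed.

(** In SL2 the norm determines the moduli of both parts, so a sphere lies on a
    torus, or on a circle when the second modulus is zero. *)
Lemma SL2_sqn {R : realType} {A : 'M[R]_2} : SL2 A ->
  sqn (conf A) = (frob A ^+ 2 + 2) / 4 /\ sqn (aconf A) = (frob A ^+ 2 - 2) / 4.
Proof.
rewrite /SL2/= det_conf_aconf sqr_frob => e.
by split; lra.
Qed.

Lemma conf_cof {R : realType} (A : 'M[R]_2) : conf (cof A) = conf A.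
Proof.
rewrite /conf /cof /Zmx !mxE !big_ord_recl !big_ord0 !mxE !big_ord_recl !big_ord0 !mxE/=.
rewrite (_ : lift ord0 ord0 = 1); last exact: val_inj.
by congr (_, _); lra.
Qed.

Lemma aconf_cof {R : realType} (A : 'M[R]_2) :
  aconf (cof A) = (- (aconf A).1, - (aconf A).2).
Proof.
rewrite /aconf /cof /Zmx !mxE !big_ord_recl !big_ord0 !mxE !big_ord_recl !big_ord0 !mxE/=.
rewrite (_ : lift ord0 ord0 = 1); last exact: val_inj.
by congr (_, _); lra.
Qed.

Lemma is_derive_entry {R : realType} (A : R -> 'M[R]_2) (t : R) i j :
  derivable A t 1 -> is_derive t 1 (fun s => A s i j) (A^`()%classic t i j).
Proof.
move=> dA; have /derivable_mxP/(_ i j) d := dA.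
by apply: DeriveDef => //; rewrite derive1E derive_mx// mxE.
Qed.

(** The equation of motion read on the conformal and anticonformal parts. *)
Lemma solution_central {R : realType} {kappa : R} {A : R -> 'M[R]_2} :
  is_solution kappa A ->
  exists2 lambda : R -> R, continuous lambda &
  central_motion (fun t => lambda t - kappa)
    (fun t => (conf (A t)).1) (fun t => (conf (A t)).2)
    (fun t => (conf (A^`()%classic t)).1) (fun t => (conf (A^`()%classic t)).2) /\
  central_motion (fun t => - (lambda t + kappa))
    (fun t => (aconf (A t)).1) (fun t => (aconf (A t)).2)
    (fun t => (aconf (A^`()%classic t)).1) (fun t => (aconf (A^`()%classic t)).2).
Proof.
move=> [_ _ [dA dA1 _] [lambda clambda eqA]]; exists lambda => //.
have d i j (t : R) := is_derive_entry A t i j (dA t).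
have d1 i j (t : R) := is_derive_entry _ t i j (dA1 t).
have {}eqA t i j : (A^`()^`())%classic t i j =
    lambda t * cof (A t) i j - kappa * A t i j.
  by have /matrixP/(_ i j) := eqA t; rewrite !mxE => <-; rewrite addrK.
have {}d1 i j (t : R) : is_derive t 1 (fun s => A^`()%classic s i j)
    (lambda t * cof (A t) i j - kappa * A t i j) by rewrite -eqA.
move: (A^`()%classic) d d1 {dA1 eqA} => B d d1.
have cc t := conf_cof (A t); have ca t := aconf_cof (A t).
split=> t.
- have := cc t; rewrite /conf/= => -[c1 c2].
  split.
  + by apply: is_derive_eq; rewrite /GRing.scale/=; lra.
  + by apply: is_derive_eq; rewrite /GRing.scale/=; lra.
  + apply: is_derive_eq; rewrite /GRing.scale/=.
    by move: (congr1 ( *%R (lambda t)) c1); lra.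
  + apply: is_derive_eq; rewrite /GRing.scale/=.
    by move: (congr1 ( *%R (lambda t)) c2); lra.
- have := ca t; rewrite /aconf/= => -[c1 c2].
  split.
  + by apply: is_derive_eq; rewrite /GRing.scale/=; lra.
  + by apply: is_derive_eq; rewrite /GRing.scale/=; lra.
  + apply: is_derive_eq; rewrite /GRing.scale/=.
    by move: (congr1 ( *%R (lambda t)) c1); lra.
  + apply: is_derive_eq; rewrite /GRing.scale/=.
    by move: (congr1 ( *%R (lambda t)) c2); lra.
Qed.

Lemma rotated_sub {R : realType} {a b : R} {u v w : R * R} :
  rotated a u v -> rotated b u w -> rotated (b - a) v w.
Proof.
case: u v w => [p q] [p' q'] [p'' q''] [/= -> ->] [/= -> ->].
have cs := cos2Dsin2 a.
by split; rewrite /= cosB sinB -[LHS]mul1r -cs; ring.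
Qed.

Lemma frob_rotated_dist {R : realType} {a b e : R} {A B : 'M[R]_2} :
  rotated a (conf A) (conf B) -> rotated b (aconf A) (aconf B) ->
  `|a| <= e -> `|b| <= e -> frob (B - A) <= e * frob A.
Proof.
move=> ra rb ae be.
have e0 : 0 <= e by exact: le_trans ae.
have sq_le x : `|x| <= e -> x ^+ 2 <= e ^+ 2.
  by move=> xe; rewrite -(real_normK (num_real x)) ler_pXn2r// nnegrE.
rewrite -(@ler_pXn2r _ 2%N)// ?nnegrE ?frob_ge0// ?mulr_ge0 ?frob_ge0//.
rewrite exprMn !sqr_frob mulrCA ler_pM2l// mulrDr lerD//.
- have -> : sqn (conf (B - A)) =
      ((conf B).1 - (conf A).1) ^+ 2 + ((conf B).2 - (conf A).2) ^+ 2.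
    by rewrite /sqn /conf !mxE /=; field.
  apply: (le_trans (rotated_dist ra)).
  by rewrite ler_wpM2r ?addr_ge0 ?sqr_ge0 ?sq_le.
- have -> : sqn (aconf (B - A)) =
      ((aconf B).1 - (aconf A).1) ^+ 2 + ((aconf B).2 - (aconf A).2) ^+ 2.
    by rewrite /sqn /aconf !mxE /=; field.
  apply: (le_trans (rotated_dist rb)).
  by rewrite ler_wpM2r ?addr_ge0 ?sqr_ge0 ?sq_le.
Qed.

Lemma entry_le_frob {R : realType} (A : 'M[R]_2) i j : `|A i j| <= frob A.
Proof.
rewrite -(@ler_pXn2r _ 2%N)// ?nnegrE ?frob_ge0// real_normK ?num_real//.
have -> : frob A ^+ 2 = A 0 0 ^+ 2 + A 0 1 ^+ 2 + A 1 0 ^+ 2 + A 1 1 ^+ 2.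
  by rewrite sqr_frob /sqn /conf /aconf /=; field.
have := (sqr_ge0 (A 0 0), sqr_ge0 (A 0 1), sqr_ge0 (A 1 0), sqr_ge0 (A 1 1)).
by case=> [[[h1 h2] h3] h4]; move: i j; apply: ord2E; apply: ord2E; lra.
Qed.

(** * The two alternatives for solutions *)

(** With [u = p ^ 2 + q ^ 2] and the constant energy [E], summing the virial
    identities of the two motions gives
    [lambda = u'' - E + 2 kappa (2 u - 1)]. *)
Lemma multiplier_periodic {R : realType} {kappa T : R}
    {lambda p q p1 q1 r s r1 s1 : R -> R} :
  central_motion (fun t => lambda t - kappa) p q p1 q1 ->
  central_motion (fun t => - (lambda t + kappa)) r s r1 s1 ->
  (forall t, p t ^+ 2 + q t ^+ 2 = r t ^+ 2 + s t ^+ 2 + 1) ->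
  periodic (fun t => p t ^+ 2 + q t ^+ 2) T -> periodic lambda T.
Proof.
move=> pq rs uv uT.
have du := is_derive_central_motion_sqnorm pq.
have dv := is_derive_central_motion_sqnorm rs.
have SE t : p t * p1 t + q t * q1 t = r t * r1 t + s t * s1 t.
  have dv1 : is_derive t 1 (fun t => r t ^+ 2 + s t ^+ 2 + 1)
      (2 * (r t * r1 t + s t * s1 t)).
    by have := dv t => dvt; apply: is_derive_eq; rewrite addr0.
  have /= := du t.
  rewrite (_ : (fun _ => _) = fun t => r t ^+ 2 + s t ^+ 2 + 1); last exact/funext.
  by move=> /is_derive1_unique/(_ dv1)/(mulfI _); apply; rewrite pnatr_eq0.
have dS := is_derive_central_motion_virial pq.
pose V t := p1 t ^+ 2 + q1 t ^+ 2 + (lambda t - kappa) * (p t ^+ 2 + q t ^+ 2).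
(* the derivative of [p p1 + q q1 = r r1 + s s1], computed on either side *)
have VE t : V t = r1 t ^+ 2 + s1 t ^+ 2
    + - (lambda t + kappa) * (r t ^+ 2 + s t ^+ 2).
  have := is_derive_central_motion_virial rs t.
  rewrite (_ : (fun _ => _) = fun t => p t * p1 t + q t * q1 t).
    by move=> /(is_derive1_unique (dS t)).
  by apply/funext => x; rewrite SE.
have ST : periodic (fun t => p t * p1 t + q t * q1 t) T.
  move=> t; have := is_derive1_periodic du uT t.
  by move=> /(mulfI _); apply; rewrite pnatr_eq0.
have VT : periodic V T := is_derive1_periodic dS ST.
pose E t := p1 t ^+ 2 + q1 t ^+ 2 + (r1 t ^+ 2 + s1 t ^+ 2)
  + kappa * (p t ^+ 2 + q t ^+ 2 + (r t ^+ 2 + s t ^+ 2)).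
have dE (t : R) : is_derive t 1 E 0.
  have hu := du t; have hv := dv t.
  have hp := is_derive_central_motion_speed pq t.
  have hr := is_derive_central_motion_speed rs t.
  rewrite /E; apply: is_derive_eq; rewrite /GRing.scale/= SE; ring.
have lambdaE t : lambda t =
    2 * V t - E 0 + 2 * kappa * (2 * (p t ^+ 2 + q t ^+ 2) - 1).
  rewrite (is_derive1_cst dE (fun=> erefl) 0 t).
  rewrite (_ : 2 * V t = V t + V t); last by ring.
  rewrite {2}VE /V /E uv; ring.
by move=> t; rewrite !lambdaE (VT t) (uT t).
Qed.

Lemma solution_quasiperiodic {R : realType} {kappa T : R} {A : R -> 'M[R]_2} :
  is_solution kappa A -> periodic (fun t => frob (A t)) T ->
  exists a b : R, forall t, rotated a (conf (A t)) (conf (A (t + T))) /\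
    rotated b (aconf (A t)) (aconf (A (t + T))).
Proof.
move=> sol fT; have [SLA _ _ _] := sol.
have [lambda cl [cz cw]] := solution_central sol.
have uT : periodic (fun t => sqn (conf (A t))) T.
  by move=> t; rewrite !(SL2_sqn (SLA _)).1 (fT t).
have vT : periodic (fun t => sqn (aconf (A t))) T.
  by move=> t; rewrite !(SL2_sqn (SLA _)).2 (fT t).
have lT : periodic lambda T.
  apply: (multiplier_periodic cz cw) => // t.
  by rewrite -!/(sqn _) (SL2_sqn (SLA _)).1 (SL2_sqn (SLA _)).2; field.
have [||a ha] := central_motion_floquet cz T _ _ uT.
  by move=> t; apply: cvgB; [exact: cl|exact: cvg_cst].
  by move=> t; rewrite lT.
have [||b hb] := central_motion_floquet cw T _ _ vT.
  by move=> t; apply: cvgN; apply: cvgD; [exact: cl|exact: cvg_cst].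
  by move=> t; rewrite lT.
exists a, b => t; split; first by move: (ha t); rewrite -!surjective_pairing.
by move: (hb t); rewrite -!surjective_pairing.
Qed.

Lemma rotated_iter {R : realType} {a T : R} {f : R -> R * R} :
  (forall t, rotated a (f t) (f (t + T))) ->
  forall (n : nat) t, rotated (n%:R * a) (f t) (f (t + n%:R * T)).
Proof.
move=> fT; elim=> [|n IH] t; first by rewrite !mul0r addr0; exact: rotated0.
by rewrite -natr1 !mulrDl !mul1r addrA; exact: rotatedD (IH t) (fT _).
Qed.

Lemma rigid_solution {R : realType} {kappa : R} {A : R -> 'M[R]_2} :
  is_solution kappa A -> rigid A ->
  exists a b : R, forall t, rotated (a * t) (conf (A 0)) (conf (A t)) /\
    rotated (b * t) (aconf (A 0)) (aconf (A t)).
Proof.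
move=> sol [c fc]; have [SLA _ _ _] := sol.
have [lambda cl [cz cw]] := solution_central sol.
have [|a ha] := central_motion_circular cz.
  by move=> t; rewrite -!/(sqn _) !(SL2_sqn (SLA _)).1 !fc.
have [|b hb] := central_motion_circular cw.
  by move=> t; rewrite -!/(sqn _) !(SL2_sqn (SLA _)).2 !fc.
exists a, b => t; split; first by move: (ha t); rewrite -!surjective_pairing.
by move: (hb t); rewrite -!surjective_pairing.
Qed.

Lemma pi2_gt0 {R : realType} : 0 < pi *+ 2 :> R.
Proof. by rewrite mulrn_wgt0 ?pi_gt0. Qed.

(** Over the time [2 l T] the two parts turn by [2 l a] and [2 l b], that is by
    [l (a / pi)] and [l (b / pi)] full turns; the approximation theorem makes
    both of these close to integers. *)
Lemma solution_almost_period {R : realType} {kappa T : R} {A : R -> 'M[R]_2}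
    (N : nat) :
  is_solution kappa A -> periodic (fun t => frob (A t)) T -> (0 < N)%N ->
  exists2 l : nat, (1 <= l <= N ^ 2)%N & forall t,
    frob (A (2 * l%:R * T + t) - A t) <= pi *+ 2 / N%:R * frob (A t).
Proof.
move=> sol fT N0; have [a [b ab]] := solution_quasiperiodic sol fT.
have [l lN [j [k [hj hk]]]] := dirichlet2 (a / pi) (b / pi) N N0.
exists l => // t.
have P := @pi2_gt0 R; have pi0 : pi != 0 :> R by rewrite gt_eqF ?pi_gt0.
have close (c : R) (m : int) : `|l%:R * (c / pi) - m%:~R| < N%:R^-1 ->
    `|(2 * l)%:R * c - m%:~R * (pi *+ 2)| <= pi *+ 2 / N%:R.
  move=> h; rewrite (_ : _ - _ = pi *+ 2 * (l%:R * (c / pi) - m%:~R)).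
    by rewrite normrM (gtr0_norm P) ler_pM2l// ltW.
  rewrite natrM -[pi *+ 2]mulr_natl; move: (@pi R) pi0 => tau tau0.
  by field.
have ra := rotated_iter (fun t => (ab t).1) (2 * l) t.
have rb := rotated_iter (fun t => (ab t).2) (2 * l) t.
rewrite (_ : 2 * l%:R * T + t = t + (2 * l)%:R * T); last first.
  by rewrite natrM addrC.
apply: (frob_rotated_dist _ _ (close a j hj) (close b k hk)).
- by apply: (rotated_period j); rewrite subrK.
- by apply: (rotated_period k); rewrite subrK.
Qed.

Lemma rigid_periodic_or_dense {R : realType} {kappa : R} {A : R -> 'M[R]_2} :
  is_solution kappa A -> rigid A ->
  (exists2 P : R, 0 < P & periodic A P) \/
  dense_in (range A) (SL2_sphere (frob (A 0))).
Proof.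
move=> sol rig; have [a [b ab]] := rigid_solution sol rig.
have [SLA _ _ _] := sol; have [c fc] := rig.
have P := @pi2_gt0 R; have P0 : pi *+ 2 != 0 :> R by rewrite gt_eqF.
have [[T T0 [j [k [aT bT]]]]|dense] := kronecker (a / (pi *+ 2)) (b / (pi *+ 2)).
  left; exists T => // t.
  have shift (d : R) (m : int) : d / (pi *+ 2) * T = m%:~R ->
      d * (t + T) = d * t + m%:~R * (pi *+ 2).
    by move=> <-; rewrite mulrAC divfK// mulrDr.
  have [ra rb] := ab (t + T); have [ra' rb'] := ab t.
  apply: conf_aconf_inj.
  - by apply: rotated_det ra'; apply: (rotated_period j); rewrite -shift.
  - by apply: rotated_det rb'; apply: (rotated_period k); rewrite -shift.
right; split.
  by move=> _ [t _ <-]; split; rewrite ?fc//; exact: SLA.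
move=> X [SLX fX] U /nbhs_ballP[e /= e0 XU].
have [|phi hphi] := rotated_exists (conf (A 0)) (conf X).
  by rewrite -!/(sqn _) (SL2_sqn SLX).1 (SL2_sqn (SLA _)).1 fX.
have [|psi hpsi] := rotated_exists (aconf (A 0)) (aconf X).
  by rewrite -!/(sqn _) (SL2_sqn SLX).2 (SL2_sqn (SLA _)).2 fX.
have F0 : 0 < frob X + 1 by rewrite ltr_wpDl ?frob_ge0.
(* the denominator is shifted by 1 only to make [d * frob X < e] strict *)
pose d := e / (frob X + 1).
have d0 : 0 < d by rewrite divr_gt0.
have [t [j [k [ta tb]]]] :=
  dense (phi / (pi *+ 2)) (psi / (pi *+ 2)) (d / (pi *+ 2)) (divr_gt0 d0 P).
exists (A t); split; first by exists t.
apply: XU.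
have aE : a * t - phi = 0 + j%:~R * (pi *+ 2).
  have -> : a * t = a / (pi *+ 2) * t * (pi *+ 2) by rewrite mulrAC divfK.
  by rewrite ta mulrDl divfK// addrAC subrr.
have bE : `|b * t - psi - k%:~R * (pi *+ 2)| <= d.
  have -> : b * t - psi - k%:~R * (pi *+ 2) =
      (b / (pi *+ 2) * t - psi / (pi *+ 2) - k%:~R) * (pi *+ 2).
    by rewrite !mulrBl !divfK// mulrAC divfK.
  by rewrite normrM (gtr0_norm P) -ler_pdivlMr// ltW.
have [ra rb] := ab t.
have dist : frob (A t - X) <= d * frob X.
  apply: (@frob_rotated_dist R 0 _ _ _ _ _ _ _ bE).
  - by apply: (rotated_period j); rewrite -aE; exact: rotated_sub hphi ra.
  - by apply: (rotated_period k); rewrite subrK; exact: rotated_sub hpsi rb.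
  - by rewrite normr0 ltW.
split=> // i j'; rewrite -ball_normE/= distrC.
have := entry_le_frob (A t - X) i j'; rewrite !mxE => /le_lt_trans; apply.
apply: (le_lt_trans dist).
by rewrite mulrAC ltr_pdivrMr// ltr_pM2l// ltrDl.
Qed.

Theorem theorem11p8 (R : realType) (kappa : R) (kappa_gt0 : 0 < kappa) :
  (forall (A : R -> 'M[R]_2) (T : R),
     is_solution kappa A ->
     ~ rigid A ->
     0 < T ->
     periodic (fun t => frob (A t)) T ->
     forall N : nat, (0 < N)%N ->
     exists l : nat, (1 <= l <= N ^ 2)%N /\
       forall t : R,
         frob (A (2 * l%:R * T + t) - A t) <= 8 * pi * frob (A t) / N%:R)
  /\
  (forall A : R -> 'M[R]_2,
     is_solution kappa A ->
     rigid A ->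
     (exists2 P : R, 0 < P & periodic A P) \/
     dense_in (range A) (SL2_sphere (frob (A 0)))).
Proof.
split=> [A T sol _ _ fT N N0|A]; last exact: rigid_periodic_or_dense.
have [l lN h] := solution_almost_period N sol fT N0.
exists l; split=> // t; apply: (le_trans (h t)).
rewrite mulrAC ler_wpM2r ?invr_ge0// -[pi *+ 2]mulr_natl ler_wpM2r ?frob_ge0//.
by rewrite ler_wpM2r ?pi_ge0// ler_nat.
Qed.
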